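(* Let $\mathfrak C$ be a left cancellative small category. The following are equivalent: (i) $I_l\ltimes\partial\Omega$ is minimal. (ii) $I_l\,\bar\ltimes\,\partial\Omega$ is minimal. (iii) For all non-empty $e,f\in\mathcal J$ there exist $s_1,\dots,s_n\in I_l$ such that for all non-empty $e'\in\mathcal J$ with $e'\le e$ there exists $1\le i\le n$ with $e'(s_ifs_i^{-1})\ne\emptyset$.
   Context: $\mathfrak C$ denotes the set of morphisms, $\mathfrak C^0\subseteq\mathfrak C$ the identity morphisms, $\mathfrak d,\mathfrak t$ domain and target; $cd$ is defined iff $\mathfrak d(c)=\mathfrak t(d)$; left cancellative means $cx=cy\Rightarrow x=y$. Each $c\in\mathfrak C$ gives the partial bijection $\mathfrak d(c)\mathfrak C\to c\mathfrak C$, $x\mapsto cx$; $I_l$ is the smallest semigroup of partial bijections of $\mathfrak C$ containing these and closed under inverses; $\mathcal J=\{\mathrm{dom}(s):s\in I_l\}$ is its semilattice of idempotents (product = intersection, $\le$ = inclusion; $sfs^{-1}$ corresponds to the set $s(f\cap\mathrm{dom}(s))$). $\bar{\mathcal J}$ is the set of subsets $\varepsilon=e\setminus\bigcup_{i=1}^nf_i$ with $e,f_i\in\mathcal J$, $f_i\subseteq e$. $\widehat{\mathcal J}$ is the space of non-zero multiplicative maps $\chi:\mathcal J\to\{0,1\}$ with $\chi(\emptyset)=0$ if $\emptyset\in\mathcal J$ (pointwise convergence). $\Omega\subseteq\widehat{\mathcal J}$ consists of those $\chi$ such that whenever $e=\bigcup_{i=1}^nf_i$ ($e,f_i\in\mathcal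 J$) and $\chi(e)=1$, then $\chi(f_i)=1$ for some $i$. For $\chi\in\Omega$, $\varepsilon=e\setminus\bigcup f_i$, put $\chi(\varepsilon)=1$ iff $\chi(e)=1$ and all $\chi(f_i)=0$, and $\chi(\varepsilon)=0$ otherwise. $\partial\Omega\subseteq\Omega$ is the closure of the set of $\chi\in\widehat{\mathcal J}$ with $\chi^{-1}(1)$ maximal. $s\in I_l$ acts by $\chi\mapsto s.\chi=\chi(s^{-1}\cdot s)$ from $\{\chi\in\partial\Omega:\chi(s^{-1}s)=1\}$ onto $\{\chi\in\partial\Omega:\chi(ss^{-1})=1\}$. $I_l\ltimes\partial\Omega$ (resp. $I_l\,\bar\ltimes\,\partial\Omega$) is the étale groupoid of classes of pairs $(s,\chi)$ with $\chi\in\partial\Omega$, $\chi(s^{-1}s)=1$, where $(s,\chi)$ and $(t,\psi)$ are identified iff $\chi=\psi$ and the restrictions satisfy $se=te$ for some $e\in\mathcal J$ with $\chi(e)=1$ (resp. $s\varepsilon=t\varepsilon$ for some $\varepsilon\in\bar{\mathcal J}$ with $\chi(\varepsilon)=1$); source $\chi$, range $s.\chi$; unit space $\partial\Omega$. A groupoid is minimal if its unit space has no closed invariant subsets other than $\emptyset$ and the whole unit space. *)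

(* Defs.v *)
From HB Require Import structures.
From mathcomp Require Import all_boot.
From mathcomp Require Import all_classical topology.

Set Implicit Arguments.
Unset Strict Implicit.
Unset Printing Implicit Defensive.

Local Open Scope classical_set_scope.
Local Open Scope quotient_scope.

(* [compose c d] is "c after d", written cd.  It is a
   total function whose value is meaningful only when [dom c = cod d]; nothing
   is required of the other values and they are never used below. *)
Record category := Category {
  obj : Type;
  mor :> Type;
  dom : mor -> obj;
  cod : mor -> obj;
  idm : obj -> mor;
  compose : mor -> mor -> mor;
  dom_idm : forall a, dom (idm a) = a;
  cod_idm : forall a, cod (idm a) = a;
  dom_compose : forall c d, dom c = cod d -> dom (compose c d) = dom d;
  cod_compose : forall c d, dom c = cod d -> cod (compose c d) = cod c;
  compose_idl : forall c, compose (idm (cod c)) c = c;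
  compose_idr : forall c, compose c (idm (dom c)) = c;
  compose_assoc : forall b c d, dom b = cod c -> dom c = cod d ->
    compose b (compose c d) = compose (compose b c) d
}.

Definition left_cancellative (C : category) :=
  forall c x y : C, dom c = cod x -> dom c = cod y ->
    compose c x = compose c y -> x = y.

Record lcCategory := LcCategory {
  lc_category :> category;
  lcP : left_cancellative lc_category
}.

Record pbij (T : Type) := PBij {
  graph : T -> T -> Prop;
  graph_fun : forall x y y', graph x y -> graph x y' -> y = y';
  graph_inj : forall x x' y, graph x y -> graph x' y -> x = x'
}.

HB.instance Definition _ T := gen_eqMixin (pbij T).
HB.instance Definition _ T := gen_choiceMixin (pbij T).

Lemma pbij_ext T (s t : pbij T) :
  (forall x y, graph s x y <-> graph t x y) -> s = t.
Proof.
case: s t => [s s1 s2] [t t1 t2] /= st.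
have E : s = t by apply/funext => x; apply/funext => y; apply/propext.
by subst t; congr PBij; exact: Prop_irrelevance.
Qed.

Section pbij_operations.
Context {T : Type}.
Implicit Types (s t : pbij T) (e : set T).

Program Definition pb_comp s t : pbij T :=
  @PBij T (fun x z => exists2 y, graph t x y & graph s y z) _ _.
Next Obligation.
move=> s t x z z' [y xy yz] [y' xy' yz'].
have E := graph_fun xy xy'; subst y'; exact: graph_fun yz yz'.
Qed.
Next Obligation.
move=> s t x x' z [y xy yz] [y' xy' yz'].
have E := graph_inj yz yz'; subst y'; exact: graph_inj xy xy'.
Qed.

Program Definition pb_inv s : pbij T := @PBij T (fun x y => graph s y x) _ _.
Next Obligation. by move=> s x y y'; exact: graph_inj. Qed.
Next Obligation. by move=> s x x' y; exact: graph_fun. Qed.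

Program Definition pb_id e : pbij T := @PBij T (fun x y => e x /\ x = y) _ _.
Next Obligation. by move=> e x y y' [_ <-] [_ <-]. Qed.
Next Obligation. by move=> e x x' y [_ ->] [_ ->]. Qed.

Definition pb_dom s : set T := [set x | exists y, graph s x y].

Definition pb_image s e : set T := [set y | exists2 x, e x & graph s x y].

Definition pb_restrict s e : pbij T := pb_comp s (pb_id e).

Lemma pb_restrictE s e x y : graph (pb_restrict s e) x y <-> e x /\ graph s x y.
Proof.
split=> [[_ [ex <-] sxy] //|[ex sxy]]; by exists x.
Qed.

Lemma pb_restrict_graph s t e x y : pb_restrict s e = pb_restrict t e ->
  e x -> graph s x y -> graph t x y.
Proof.
move=> st ex sxy; have /pb_restrictE[] // : graph (pb_restrict t e) x y.
by rewrite -st; apply/pb_restrictE.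
Qed.

Lemma pb_restrict_sub s t e f : f `<=` e ->
  pb_restrict s e = pb_restrict t e -> pb_restrict s f = pb_restrict t f.
Proof.
move=> fe E; apply: pbij_ext => x y; rewrite !pb_restrictE.
by split=> -[fx xy]; split=> //; apply: pb_restrict_graph (fe _ fx) xy.
Qed.

End pbij_operations.

(* The partial bijection d(c)C -> cC, x |-> cx. *)
Program Definition lmul (C : lcCategory) (c : C) : pbij C :=
  @PBij C (fun x y => dom c = cod x /\ y = compose c x) _ _.
Next Obligation. by move=> C c x y y' [_ ->] [_ ->]. Qed.
Next Obligation.
by move=> C c x x' y [cx ->] [cx' E]; exact: lcP cx cx' E.
Qed.

Inductive in_Il (C : lcCategory) : pbij C -> Prop :=
| in_Il_lmul c : in_Il (lmul c)
| in_Il_inv s : in_Il s -> in_Il (pb_inv s)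
| in_Il_comp s t : in_Il s -> in_Il t -> in_Il (pb_comp s t).

Definition Il (C : lcCategory) : set (pbij C) := [set s | in_Il s].

Definition J (C : lcCategory) : set (set C) := [set pb_dom s | s in @Il C].

Arguments Il : clear implicits.
Arguments J : clear implicits.

Section semilattice.
Context {C : lcCategory}.
Implicit Types (s t : Il C) (e f : J C).

Lemma IlP s : in_Il (val s). Proof. exact: set_valP. Qed.

Definition mkIl (s : pbij C) (h : in_Il s) : Il C := exist _ s (mem_set h).

Definition mkJ (e : set C) (h : J C e) : J C := exist _ e (mem_set h).

Definition Il_mul s t : Il C := mkIl (in_Il_comp (IlP s) (IlP t)).

Definition Il_inv s : Il C := mkIl (in_Il_inv (IlP s)).

Lemma J_dom_subproof s : J C (pb_dom (val s)).
Proof. by exists (val s) => //; exact: IlP. Qed.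

(* The idempotent s^-1 s. *)
Definition Jdom s : J C := mkJ (J_dom_subproof s).

Lemma Il_id_subproof e : in_Il (pb_id (val e)).
Proof.
have [s sI <-] := set_valP e.
suff -> : pb_id (pb_dom s) = pb_comp (pb_inv s) s.
  by apply: in_Il_comp => //; exact: in_Il_inv.
apply: pbij_ext => x y; split=> /= [[[z xz] <-]|[z xz yz]]; first by exists z.
by split; [exists z|exact: graph_inj xz yz].
Qed.

Definition Il_id e : Il C := mkIl (Il_id_subproof e).

Lemma J_meet_subproof e f : J C (val e `&` val f).
Proof.
exists (pb_comp (pb_id (val e)) (pb_id (val f))).
  by apply: in_Il_comp; exact: Il_id_subproof.
apply/seteqP; split=> [x [y [_ [fx <-] [ex _]]] //|x [ex fx]].
by exists x; exists x.
Qed.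

Definition Jmeet e f : J C := mkJ (J_meet_subproof e f).

Lemma J_conj_subproof s e : J C (pb_image (val s) (val e)).
Proof.
exists (pb_comp (pb_id (val e)) (pb_inv (val s))).
  by apply: in_Il_comp; [exact: Il_id_subproof|apply/in_Il_inv/IlP].
apply/seteqP; split=> [x [y [z xz [ez _]]]|x [z ez xz]]; first by exists z.
by exists z; exists z.
Qed.

(* The idempotent s e s^-1, i.e. the set s(e `&` dom s). *)
Definition Jconj s e : J C := mkJ (J_conj_subproof s e).

Lemma J_ext e f : (forall x, val e x <-> val f x) -> e = f.
Proof. by move=> H; apply/val_inj/seteqP; split=> x /H. Qed.

End semilattice.

(* eps = e \ (f_1 `|` ... `|` f_n): the sets eps with such a presentation form
   \bar J.  The case n = 0 is allowed, so that J is contained in \bar J. *)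
Definition Jbar_presentation (C : lcCategory) (e : J C) (fs : seq (J C))
    (eps : set C) : Prop :=
  (forall f, f \in fs -> val f `<=` val e) /\
  eps = val e `\` \bigcup_(f in [set` fs]) val f.

Section characters.
Context {C : lcCategory}.
Local Notation fspace := {ptws J C -> bool}.
Implicit Types (chi psi : fspace) (s t : Il C) (e f : J C).

Definition Jhat : set fspace := [set chi : fspace |
  [/\ exists e, chi e,
      forall e f, chi (Jmeet e f) = chi e && chi f &
      forall e, val e = set0 -> chi e = false]].

Definition Omega : set fspace := [set chi : fspace | Jhat chi /\
  forall e (fs : seq (J C)), val e = \bigcup_(f in [set` fs]) val f ->
    chi e -> exists2 f, f \in fs & chi f].

Definition max_character : set fspace := [set chi : fspace | Jhat chi /\
  forall psi, Jhat psi -> [set e | chi e] `<=` [set e | psi e] ->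
    [set e | psi e] = [set e | chi e]].

(* The closure is taken in the subspace [Omega]. *)
Definition bdOmega : set fspace := Omega `&` closure max_character.

(* [ext_eval chi eps] says that eps is in \bar J and chi(eps) = 1; when chi is
   in [Omega] this does not depend on the presentation of eps, see
   [ext_eval_indep]. *)
Definition ext_eval chi (eps : set C) : Prop :=
  exists e fs, [/\ Jbar_presentation e fs eps, chi e &
                   forall f, f \in fs -> ~~ chi f].

(* s.chi = chi(s^-1 _ s); used only when chi(s^-1 s) = 1. *)
Definition act s chi : fspace := fun e => chi (Jconj (Il_inv s) e).

End characters.

Arguments bdOmega : clear implicits.
Arguments Omega : clear implicits.
Arguments Jhat : clear implicits.
Arguments max_character : clear implicits.

Section action_facts.
Context {C : lcCategory}.
Local Notation fspace := {ptws J C -> bool}.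
Implicit Types (chi psi : fspace) (s t : Il C) (e f : J C).

Lemma ext_eval_indep chi e fs e' fs' eps : Omega C chi ->
  Jbar_presentation e fs eps -> Jbar_presentation e' fs' eps ->
  chi e -> (forall f, f \in fs -> ~~ chi f) ->
  chi e' /\ (forall f, f \in fs' -> ~~ chi f).
Proof.
move=> [[_ chiM _] chiU] [fe epsE] [fe' epsE'] ce cf.
have HM a b : chi a -> chi b -> chi (Jmeet a b) by rewrite chiM => -> ->.
have Hmono a b : val a `<=` val b -> chi a -> chi b.
  move=> ab ca; have E : Jmeet a b = a.
    by apply: J_ext => x; split=> [[]//|ax]; split=> //; exact: ab.
  by move: ca; rewrite -E chiM => /andP[].
have ce' : chi e'.
  have [|f] := chiU e (Jmeet e e' :: fs) _ ce.
    apply/seteqP; split=> x.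
      move=> ex; have [[f /= ff fx]|nf] := pselect ((\bigcup_(f in [set` fs]) val f) x).
        by exists f => //=; rewrite inE ff orbT.
      exists (Jmeet e e'); first by rewrite /= inE eqxx.
      split=> //; have : eps x by rewrite epsE.
      by rewrite epsE' => -[].
    move=> [f /=]; rewrite inE => /predU1P[-> [//]|/fe]; exact.
  rewrite inE => /predU1P[-> |/cf/negP //]; rewrite chiM.
  by move=> /andP[].
split=> // f ff'; apply/negP => cfx.
have cm : chi (Jmeet e f) by exact: HM.
have [|g /mapP[h hfs ->]] := chiU (Jmeet e f) [seq Jmeet f h | h <- fs] _ cm.
  apply/seteqP; split=> x.
    move=> [ex fx].
    have [[h /= hh hx]|nh] := pselect ((\bigcup_(f in [set` fs]) val f) x).
      by exists (Jmeet f h) => //=; exact: map_f.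
    have : eps x by rewrite epsE.
    by rewrite epsE' => -[_] []; exists f.
  by move=> [_ /mapP[h hh ->] [fx hx]]; split=> //; exact: fe hx.
by rewrite chiM => /andP[_]; apply/negP; exact: cf.
Qed.

Lemma Jhat_mono chi e f : Jhat C chi -> val e `<=` val f -> chi e -> chi f.
Proof.
move=> [_ chiM _] ef ce; have E : Jmeet e f = e.
  by apply: J_ext => x; split=> [[]//|ex]; split=> //; exact: ef.
by move: ce; rewrite -E chiM => /andP[].
Qed.

Lemma Jhat_meet chi e f : Jhat C chi -> chi e -> chi f -> chi (Jmeet e f).
Proof. by move=> [_ chiM _] ce cf; rewrite chiM ce cf. Qed.

Lemma Jconj_invE s e x :
  val (Jconj (Il_inv s) e) x <-> exists2 y, val e y & graph (val s) x y.
Proof. by []. Qed.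

Lemma act_mul s t chi : act (Il_mul s t) chi = act s (act t chi).
Proof.
apply/funext => e; rewrite /act; congr (chi _); apply: J_ext => x; split.
  by move=> [y ey [z xz zy]]; exists z => //; exists y.
by move=> [z [y ey zy] xz]; exists y => //; exists z.
Qed.

Lemma act_id e chi : Jhat C chi -> chi e -> act (Il_id e) chi = chi.
Proof.
move=> chiJ ce; apply/funext => f; rewrite /act.
have -> : Jconj (Il_inv (Il_id e)) f = Jmeet e f.
  apply: J_ext => x; split=> [[y fy [ex xy]]|[ex fx]].
    by subst y; split.
  by exists x.
by case: chiJ => _ -> _; rewrite ce.
Qed.

Lemma act_invK s chi : Jhat C chi -> chi (Jdom s) ->
  act (Il_inv s) (act s chi) = chi.
Proof.
move=> chiJ cs; rewrite -act_mul -[RHS](act_id chiJ cs).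
suff -> : Il_mul (Il_inv s) s = Il_id (Jdom s) by [].
apply/val_inj/pbij_ext => x y /=; split=> [[z xz yz]|[[z xz] xy]].
  by split; [exists z|exact: graph_inj xz yz].
by subst y; exists z.
Qed.

Lemma Jdom_mul s t chi : chi (Jdom (Il_mul s t)) = act t chi (Jdom s).
Proof.
rewrite /act; congr (chi _); apply: J_ext => x; split.
  by move=> [z [y xy yz]]; exists y => //; exists z.
by move=> [y [z yz] xy]; exists z; exists y.
Qed.

Lemma Jdom_inv s chi : Jhat C chi -> chi (Jdom s) ->
  act s chi (Jdom (Il_inv s)).
Proof.
move=> chiJ; apply: (Jhat_mono chiJ) => x [y xy].
by exists y => //; exists x.
Qed.

Lemma Jhat_act s chi : Jhat C chi -> chi (Jdom s) -> Jhat C (act s chi).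
Proof.
move=> chiJ cs; split.
- by exists (Jdom (Il_inv s)); exact: Jdom_inv.
- move=> e f; case: (chiJ) => _ <- _; congr (chi _); apply: J_ext => x; split.
    by move=> [y [ey fy] xy]; split; exists y.
  move=> [[y ey xy] [z fz xz]]; exists y => //; split=> //.
  by rewrite (graph_inj xy xz).
- move=> e e0; case: chiJ => _ _; apply; apply/seteqP; split=> // x [y].
  by rewrite e0.
Qed.

Lemma Omega_act s chi : Omega C chi -> chi (Jdom s) -> Omega C (act s chi).
Proof.
move=> [chiJ chiU] cs; split; first exact: Jhat_act.
move=> e fs ee ce.
have [|_ /mapP[f ff ->] cf] := chiU _ [seq Jconj (Il_inv s) f | f <- fs] _ ce;
  last by exists f.
apply/seteqP; split=> x.
  move=> [y]; rewrite ee => -[f ff fy] xy.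
  by exists (Jconj (Il_inv s) f); [exact: map_f|exists y].
move=> [_ /mapP[f ff ->]] [y fy xy]; exists y => //.
by rewrite ee; exists f.
Qed.

Lemma max_character_act s chi : max_character C chi -> chi (Jdom s) ->
  max_character C (act s chi).
Proof.
move=> [chiJ chiM] cs; split; first exact: Jhat_act.
move=> psi psiJ sub.
have ps : psi (Jdom (Il_inv s)) by apply/sub/Jdom_inv.
have E : [set e | act (Il_inv s) psi e] = [set e | chi e].
  apply: chiM; first exact: Jhat_act.
  move=> e /= ce; apply/sub; rewrite /= -[chi](act_invK chiJ cs) in ce.
  exact: ce.
have {}E : act (Il_inv s) psi = chi.
  apply/funext => e; have := congr1 (fun A : set _ => A e) E => /= {}E.
  by apply/idP/idP; rewrite E.
have -> // : act s chi = psi.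
rewrite -E -[RHS](act_invK psiJ ps).
suff -> : Il_inv (Il_inv s) = s by [].
exact/val_inj/pbij_ext.
Qed.

Lemma eval_continuous e : continuous (fun chi : fspace => chi e).
Proof. exact: (@proj_continuous _ (fun _ : J C => bool)). Qed.

Lemma eval_open e : open [set chi : fspace | chi e].
Proof.
rewrite (_ : [set _ | _] = (fun chi : fspace => chi e) @^-1` [set true]).
  by apply: open_comp => [chi _|]; [exact: eval_continuous|exact: discrete_open].
by apply/seteqP; split=> chi /= /eqP; rewrite ?eqb_id // => /eqP.
Qed.

Lemma eval_openN e : open [set chi : fspace | ~~ chi e].
Proof.
rewrite (_ : [set _ | _] = (fun chi : fspace => chi e) @^-1` [set false]).
  by apply: open_comp => [chi _|]; [exact: eval_continuous|exact: discrete_open].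
by apply/seteqP; split=> chi /= /negP; [case: (chi e)|move=> /negP; case: (chi e)].
Qed.

Lemma act_continuous s : continuous (act s : fspace -> fspace).
Proof.
move=> chi; apply/cvg_sup => e A [_ [[V oV <-] Vx VA]].
have /(_ V) := @eval_continuous (Jconj (Il_inv s) e) chi.
move=> /(_ (open_nbhs_nbhs (conj oV Vx))).
by rewrite /= !nbhs_simpl /= => h; apply: (filterS _ h) => psi; exact: VA.
Qed.

Lemma bdOmega_act s chi : bdOmega C chi -> chi (Jdom s) ->
  bdOmega C (act s chi).
Proof.
move=> [chiO chiM] cs; split; first exact: Omega_act.
move=> B nB'; have nB : nbhs chi (act s @^-1` B) by exact: act_continuous nB'.
have nD : nbhs chi [set psi : fspace | psi (Jdom s)].
  by apply: open_nbhs_nbhs; split=> //; exact: eval_open.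
have [psi [psiM [/= Bpsi Dpsi]]] := chiM _ (filterI nB nD).
by exists (act s psi); split=> //; exact: max_character_act.
Qed.

Lemma ext_eval_meet chi a b : Omega C chi ->
  ext_eval chi a -> ext_eval chi b -> ext_eval chi (a `&` b).
Proof.
move=> [chiJ _] [e [fs [[fe ->] ce cf]]] [e' [fs' [[fe' ->] ce' cf']]].
exists (Jmeet e e').
exists ([seq Jmeet f e' | f <- fs] ++ [seq Jmeet e f | f <- fs']).
split; last 2 first.
- exact: Jhat_meet.
- case: (chiJ) => _ chiM _ f; rewrite mem_cat => /orP[] /mapP[g gg ->].
    by rewrite chiM negb_and cf.
  by rewrite chiM negb_and (cf' _ gg) orbT.
split.
  move=> f; rewrite mem_cat => /orP[] /mapP[g gg ->] x [] /=.
    by move=> /(fe _ gg) ex e'x.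
  by move=> ex /(fe' _ gg) e'x.
apply/seteqP; split=> x.
  move=> [[ex nx] [e'x n'x]]; split=> // -[f].
  rewrite /= mem_cat => /orP[] /mapP[g gg ->] [gx g'x].
    by apply: nx; exists g.
  by apply: n'x; exists g.
move=> [[ex e'x] nx]; split; split=> // -[f ff fx]; apply: nx.
  by exists (Jmeet f e') => //=; rewrite mem_cat (map_f (Jmeet^~ e')).
by exists (Jmeet e f) => //=; rewrite mem_cat (map_f (Jmeet e)) ?orbT.
Qed.

Lemma ext_eval_act s chi a : Omega C chi -> chi (Jdom s) ->
  ext_eval (act s chi) a -> ext_eval chi (pb_image (pb_inv (val s)) a).
Proof.
move=> [chiJ _] cs [e [fs [[fe ->] ce cf]]].
exists (Jconj (Il_inv s) e), [seq Jconj (Il_inv s) f | f <- fs]; split=> //.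
  split.
    by move=> _ /mapP[f ff ->] x [y fy xy]; exists y => //; exact: fe fy.
  apply/seteqP; split=> x.
    move=> [y [ey ny] xy]; split; first by exists y.
    move=> [_ /mapP[f ff ->] [z fz xz]]; apply: ny; exists f => //.
    by rewrite (graph_inj xy xz).
  move=> [[y ey xy] nx]; exists y => //; split=> // -[f ff fy]; apply: nx.
  by exists (Jconj (Il_inv s) f); [exact: map_f|exists y].
by move=> _ /mapP[f ff ->]; exact: cf.
Qed.

Lemma ext_eval_sub chi a e f : Omega C chi -> ext_eval chi a -> chi e ->
  a `&` val e `<=` val f -> chi f.
Proof.
move=> [chiJ chiU] [e' [fs [[fe ->] ce' cf]]] ce sub.
have cm := Jhat_meet chiJ ce' ce.
have [|g] := chiU _ (Jmeet (Jmeet e' e) f :: [seq Jmeet g e | g <- fs]) _ cm.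
  apply/seteqP; split=> x.
    move=> [e'x ex].
    have [[g gg gx]|ng] := pselect ((\bigcup_(g in [set` fs]) val g) x).
      by exists (Jmeet g e) => //=; rewrite inE (map_f (Jmeet^~ e)) ?orbT.
    exists (Jmeet (Jmeet e' e) f); first by rewrite /= inE eqxx.
    by split=> //; apply: sub.
  move=> [g /=]; rewrite inE => /predU1P[-> [] //|/mapP[h hh ->] [hx ex]].
  by split=> //; exact: fe hx.
case: (chiJ) => _ chiM _; rewrite inE => /predU1P[->|/mapP[h hh ->]].
  by rewrite chiM => /andP[].
by rewrite chiM (negbTE (cf _ hh)).
Qed.

Lemma ext_eval_open chi a : ext_eval chi a ->
  exists U : set fspace, [/\ open U, U chi & forall psi, U psi -> ext_eval psi a].
Proof.
move=> [e [fs [pres ce cf]]].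
exists ([set psi : fspace | psi e] `&`
        [set psi : fspace | forall f, f \in fs -> ~~ psi f]); split=> //.
- apply: openI; first exact: eval_open.
  elim: fs {pres cf} => [|f fs IH].
    rewrite (_ : [set _ | _] = setT); first exact: openT.
    by apply/seteqP; split.
  rewrite (_ : [set _ | _] = [set psi : fspace | ~~ psi f] `&`
    [set psi : fspace | forall g, g \in fs -> ~~ psi g]).
    by apply: openI => //; exact: eval_openN.
  apply/seteqP; split=> psi /=.
    move=> H; split; first by apply: H; rewrite inE eqxx.
    by move=> g gg; apply: H; rewrite inE gg orbT.
  by move=> [H1 H2] g; rewrite inE => /predU1P[->//|]; exact: H2.
- by move=> psi [pe pf]; exists e, fs.
Qed.

End action_facts.

(* [germ_family C] abstracts the two notions of germ: [gf_eval F chi a] says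
   that restrictions to the set a may be used to identify germs at chi. *)
Record germ_family (C : lcCategory) := GermFamily {
  gf_eval : {ptws J C -> bool} -> set (set C);
  gf_J : forall (chi : {ptws J C -> bool}) (e : J C),
    chi e -> gf_eval chi (val e);
  gf_meet : forall (chi : {ptws J C -> bool}) a b, Omega C chi ->
    gf_eval chi a -> gf_eval chi b -> gf_eval chi (a `&` b);
  gf_act : forall (s : Il C) (chi : {ptws J C -> bool}) a,
    Omega C chi -> chi (Jdom s) ->
    gf_eval (act s chi) a -> gf_eval chi (pb_image (pb_inv (val s)) a);
  gf_sub : forall (chi : {ptws J C -> bool}) a (e f : J C),
    Omega C chi -> gf_eval chi a -> chi e -> a `&` val e `<=` val f -> chi f;
  gf_open : forall (chi : {ptws J C -> bool}) a, gf_eval chi a ->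
    exists U : set {ptws J C -> bool},
      [/\ open U, U chi & forall psi, U psi -> gf_eval psi a]
}.

Definition germJ_eval (C : lcCategory) (chi : {ptws J C -> bool}) :
  set (set C) := [set a | exists2 e : J C, val e = a & chi e].

Program Definition germJ (C : lcCategory) : germ_family C :=
  @GermFamily C (@germJ_eval C) _ _ _ _ _.
Next Obligation. by move=> C chi e ce; exists e. Qed.
Next Obligation.
move=> C chi a b [chiJ _] [e <- ce] [f <- cf].
by exists (Jmeet e f) => //; exact: Jhat_meet.
Qed.
Next Obligation.
by move=> C s chi a _ _ [e <- ce]; exists (Jconj (Il_inv s) e).
Qed.
Next Obligation.
move=> C chi a e f [chiJ _] [e' <- ce'] ce sub.
by apply: (@Jhat_mono _ _ (Jmeet e' e)) => //; exact: Jhat_meet.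
Qed.
Next Obligation.
move=> C chi a [e <- ce]; exists [set psi : {ptws J C -> bool} | psi e].
by split=> //; [exact: eval_open|move=> psi pe; exists e].
Qed.

Program Definition germJbar (C : lcCategory) : germ_family C :=
  @GermFamily C (@ext_eval C) _ _ _ _ _.
Next Obligation.
move=> C chi e ce; exists e, [::]; split=> //; split=> //.
by apply/seteqP; split=> [x ex|x []//]; split=> // -[].
Qed.
Next Obligation. by move=> C; exact: ext_eval_meet. Qed.
Next Obligation. by move=> C; exact: ext_eval_act. Qed.
Next Obligation. by move=> C; exact: ext_eval_sub. Qed.
Next Obligation. by move=> C; exact: ext_eval_open. Qed.

(* [gmul g h] is meaningful only when [src g = rng h]. *)
Record etale_groupoid := EtaleGroupoid {
  unit_space : topologicalType;
  arrow : topologicalType;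
  src : arrow -> unit_space;
  rng : arrow -> unit_space;
  gone : unit_space -> arrow;
  ginv : arrow -> arrow;
  gmul : arrow -> arrow -> arrow;
  src_one : forall x, src (gone x) = x;
  rng_one : forall x, rng (gone x) = x;
  src_inv : forall g, src (ginv g) = rng g;
  rng_inv : forall g, rng (ginv g) = src g;
  src_mul : forall g h, src g = rng h -> src (gmul g h) = src h;
  rng_mul : forall g h, src g = rng h -> rng (gmul g h) = rng g;
  gmulA : forall g h k, src g = rng h -> src h = rng k ->
    gmul g (gmul h k) = gmul (gmul g h) k;
  gmul1g : forall g, gmul (gone (rng g)) g = g;
  gmulg1 : forall g, gmul g (gone (src g)) = g;
  gmulVg : forall g, gmul (ginv g) g = gone (src g);
  gmulgV : forall g, gmul g (ginv g) = gone (rng g);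
  src_continuous : continuous src;
  gone_continuous : continuous gone;
  ginv_continuous : continuous ginv;
  gmul_continuous : {within [set gh : arrow * arrow | src gh.1 = rng gh.2],
    continuous (fun gh => gmul gh.1 gh.2)};
  src_local_homeo : forall g, exists U : set arrow,
    [/\ open U, U g, {in U &, injective src} &
        forall V, open V -> V `<=` U -> open (src @` V)]
}.

Definition invariant_set (G : etale_groupoid) (A : set (unit_space G)) : Prop :=
  forall g : arrow G, A (src g) -> A (rng g).

Definition minimal_groupoid (G : etale_groupoid) : Prop :=
  forall A : set (unit_space G), closed A -> invariant_set A ->
    A = set0 \/ A = setT.

Section germ_groupoid.
Context {C : lcCategory} (F : germ_family C).
Local Notation bdO := (bdOmega C).
Implicit Types (s t : Il C) (e : J C) (chi psi : bdO).

Lemma bdOP chi : bdOmega C (val chi). Proof. exact: set_valP. Qed.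
Lemma bdO_Omega chi : Omega C (val chi). Proof. by case: (bdOP chi). Qed.
Lemma bdO_Jhat chi : Jhat C (val chi). Proof. by case: (bdO_Omega chi). Qed.

Definition bd_act s chi (h : val chi (Jdom s)) : bdO :=
  exist _ (act s (val chi)) (mem_set (bdOmega_act (bdOP chi) h)).

Definition germ_pairs : set (discrete_topology (Il C) * bdO) :=
  [set p : discrete_topology (Il C) * bdO | val p.2 (Jdom (p.1 : Il C))].

Definition germ_eq (p q : germ_pairs) : Prop :=
  (val p).2 = (val q).2 /\
  exists2 a, gf_eval F (val (val p).2) a &
    pb_restrict (val ((val p).1 : Il C)) a = pb_restrict (val ((val q).1 : Il C)) a.

Lemma germ_eq_refl : reflexive (fun p q => `[< germ_eq p q >]).
Proof.
move=> p; apply/asboolP; split=> //.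
exists (val (Jdom ((val p).1 : Il C))) => //; apply: gf_J.
exact: (set_valP p).
Qed.

Lemma germ_eq_sym : symmetric (fun p q => `[< germ_eq p q >]).
Proof.
suff H p q : germ_eq p q -> germ_eq q p.
  by move=> p q; apply/asboolP/asboolP; exact: H.
by move=> [E [a]]; rewrite E => Ea st; split=> //; exists a.
Qed.

Lemma germ_eq_trans : transitive (fun p q => `[< germ_eq p q >]).
Proof.
move=> q p r /asboolP[E [a Ea st]] /asboolP[E' [b Eb tu]]; apply/asboolP.
split; first by rewrite E.
exists (a `&` b).
  by apply: gf_meet => //; [exact: bdO_Omega|rewrite E].
rewrite (pb_restrict_sub (@subIsetl _ a b) st).
exact: (pb_restrict_sub (@subIsetr _ a b) tu).
Qed.

Canonical germ_equiv := EquivRel _ germ_eq_refl germ_eq_sym germ_eq_trans.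

(* The quotient topology, I_l being discrete; a basis of open sets is given by
   the sets of germs [germ s chi] with s fixed and chi in an open set. *)
Definition germs : Type := quotient_topology {eq_quot germ_equiv}.

HB.instance Definition _ := Topological.on germs.

Definition mkpair s chi (h : val chi (Jdom s)) : germ_pairs :=
  exist _ (s : discrete_topology (Il C), chi) (mem_set h).

Definition germ s chi (h : val chi (Jdom s)) : germs :=
  \pi_(quotient_topology {eq_quot germ_equiv}) (mkpair h).

Lemma germP s t chi psi (h : val chi (Jdom s)) (k : val psi (Jdom t)) :
  germ h = germ k <-> chi = psi /\ exists2 a, gf_eval F (val chi) a &
    pb_restrict (val s) a = pb_restrict (val t) a.
Proof.
split; first by move=> /eqmodP/asboolP.
by move=> H; apply/eqmodP/asboolP.
Qed.

Lemma germ_irr s chi psi (h : val chi (Jdom s)) (k : val psi (Jdom s)) :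
  chi = psi -> germ h = germ k.
Proof. by move=> E; subst psi; congr germ; exact: Prop_irrelevance. Qed.

Lemma germ_ind (P : germs -> Prop) :
  (forall s chi (h : val chi (Jdom s)), P (germ h)) -> forall g, P g.
Proof.
move=> H g; rewrite -[g]reprK; case: (repr g) => -[s chi] hm.
have h : val chi (Jdom (s : Il C)) by exact: (set_mem hm).
have -> : exist _ (s, chi) hm = mkpair h by exact: val_inj.
exact: H.
Qed.

Definition germ_rep_Il (g : germs) : Il C := (val (repr g)).1.
Definition germ_src (g : germs) : bdO := (val (repr g)).2.

Lemma germ_repP g : val (germ_src g) (Jdom (germ_rep_Il g)).
Proof. exact: (set_valP (repr g)). Qed.

Lemma germ_repK g : germ (germ_repP g) = g.
Proof.
rewrite -[RHS]reprK; congr (\pi _); apply: val_inj => /=.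
by rewrite /germ_rep_Il /germ_src -surjective_pairing.
Qed.

Definition germ_rng (g : germs) : bdO := bd_act (germ_repP g).

Lemma germ_srcE s chi (h : val chi (Jdom s)) : germ_src (germ h) = chi.
Proof. by have /germP[] := germ_repK (germ h). Qed.

Lemma act_local s t chi a : gf_eval F (val chi) a ->
  pb_restrict (val s) a = pb_restrict (val t) a ->
  act s (val chi) = act t (val chi).
Proof.
move=> Ea.
suff H u v : pb_restrict (val u) a = pb_restrict (val v) a ->
    forall f, act u (val chi) f -> act v (val chi) f.
  by move=> st; apply/funext => f; apply/idP/idP; exact: H.
rewrite /act => uv f cf.
apply: (gf_sub (bdO_Omega chi) Ea cf) => x [ax [y fy /= xy]].
by exists y => //; exact: pb_restrict_graph uv ax xy.
Qed.

Lemma germ_rngE s chi (h : val chi (Jdom s)) : germ_rng (germ h) = bd_act h.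
Proof.
have /germP[E [a Ea st]] := germ_repK (germ h).
apply: val_inj => /=; rewrite germ_srcE in Ea *.
exact: act_local Ea st.
Qed.

Lemma germ_inv_subproof s chi (h : val chi (Jdom s)) :
  val (bd_act h) (Jdom (Il_inv s)).
Proof. by apply: Jdom_inv => //; exact: bdO_Jhat. Qed.

(* [s, chi]^-1 = [s^-1, s.chi] *)
Definition germ_inv (g : germs) : germs :=
  germ (germ_inv_subproof (germ_repP g)).

Lemma germ_invE s chi (h : val chi (Jdom s)) :
  germ_inv (germ h) = germ (germ_inv_subproof h).
Proof.
have /germP[E [a Ea st]] := germ_repK (germ h).
have cE := germ_rngE h; apply/germP; split=> //.
exists (pb_image (val (germ_rep_Il (germ h))) a).
  set u := germ_rep_Il _; have hu := germ_repP (germ h).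
  have := @gf_act _ F (Il_inv u) (act u (val (germ_src (germ h)))) a.
  move=> /(_ _ _ _); rewrite act_invK //; last exact: bdO_Jhat.
  apply => //; last exact: germ_inv_subproof.
  exact: (bdO_Omega (bd_act hu)).
apply: pbij_ext => y x; rewrite !pb_restrictE.
split=> -[[z az zy] xy]; split; try by exists z.
  have E' := graph_inj zy xy; subst z; exact: pb_restrict_graph st az xy.
have zy' := pb_restrict_graph st az zy.
by have E' := graph_inj zy' xy; subst z.
Qed.

Lemma germ_mul_subproof s t chi psi (h : val chi (Jdom s))
    (k : val psi (Jdom t)) : chi = bd_act k -> val psi (Jdom (Il_mul s t)).
Proof. by move=> E; rewrite Jdom_mul; move: h; rewrite E. Qed.

Lemma germ_rep_composable g h : germ_src g = germ_rng h ->
  val (germ_src h) (Jdom (Il_mul (germ_rep_Il g) (germ_rep_Il h))).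
Proof. exact: germ_mul_subproof (germ_repP g) (germ_repP h). Qed.

(* [s, t.chi][t, chi] = [st, chi]; the value is irrelevant on pairs that are
   not composable. *)
Definition germ_mul (g h : germs) : germs :=
  if pselect (germ_src g = germ_rng h) is left e
  then germ (germ_rep_composable e) else g.

Lemma germ_mulE s t chi (k : val chi (Jdom t)) (h : val (bd_act k) (Jdom s))
  (st : val chi (Jdom (Il_mul s t))) : germ_mul (germ h) (germ k) = germ st.
Proof.
rewrite /germ_mul; case: pselect; last by rewrite germ_srcE germ_rngE.
move=> e; have /germP[E1 [a Ea sa]] := germ_repK (germ h).
have /germP[E2 [b Eb tb]] := germ_repK (germ k).
apply/germP; split=> //.
rewrite germ_srcE in Ea; rewrite E2 in Eb *.
exists (b `&` pb_image (pb_inv (val t)) a).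
  apply: gf_meet => //; first exact: bdO_Omega.
  exact: (gf_act (bdO_Omega chi) k Ea).
apply: pbij_ext => x z; rewrite !pb_restrictE.
split=> -[[bx [y ay xy]] [y' xy' yz]]; split.
- by split=> //; exists y.
- have xy2 := pb_restrict_graph tb bx xy'.
  exists y' => //; apply: (pb_restrict_graph sa) yz.
  by rewrite (graph_fun xy2 xy).
- by split=> //; exists y.
- exists y'; first exact: pb_restrict_graph (esym tb) bx xy'.
  by apply: (pb_restrict_graph (esym sa)) yz; rewrite (graph_fun xy' xy).
Qed.

Lemma germ_one_subproof chi : { e : J C | val chi e }.
Proof. by apply: cid; case: (bdO_Jhat chi). Qed.

Lemma Jdom_id e : Jdom (Il_id e) = e.
Proof. by apply: J_ext => x; split=> [[y []]//|ex]; exists x. Qed.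

Lemma germ_one_subproof2 chi :
  val chi (Jdom (Il_id (sval (germ_one_subproof chi)))).
Proof. by rewrite Jdom_id; case: germ_one_subproof. Qed.

(* The unit at chi is [e, chi] for any idempotent e with chi(e) = 1. *)
Definition germ_one chi : germs := germ (germ_one_subproof2 chi).

Lemma germ_oneE chi e (h : val chi (Jdom (Il_id e))) : germ_one chi = germ h.
Proof.
rewrite /germ_one; case: germ_one_subproof (germ_one_subproof2 chi) => f fP k.
apply/germP; split=> //; exists (val (Jmeet e f)).
  by apply: gf_J; apply: Jhat_meet => //; [exact: bdO_Jhat|rewrite -[e]Jdom_id].
apply: pbij_ext => x y; rewrite !pb_restrictE.
by split=> -[[ex fx] [_ <-]].
Qed.

Lemma bd_act_id e chi (h : val chi (Jdom (Il_id e))) : bd_act h = chi.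
Proof.
apply: val_inj => /=; apply: act_id; first exact: bdO_Jhat.
by rewrite -[e]Jdom_id.
Qed.

Lemma germ_src_one chi : germ_src (germ_one chi) = chi.
Proof. exact: germ_srcE. Qed.

Lemma germ_rng_one chi : germ_rng (germ_one chi) = chi.
Proof. by rewrite germ_rngE bd_act_id. Qed.

Lemma germ_src_inv g : germ_src (germ_inv g) = germ_rng g.
Proof. exact: germ_srcE. Qed.

Lemma germ_rng_inv g : germ_rng (germ_inv g) = germ_src g.
Proof.
rewrite germ_rngE; apply: val_inj => /=; apply: act_invK; first exact: bdO_Jhat.
exact: germ_repP.
Qed.

Lemma composableP s chi (h : val chi (Jdom s)) (g : germs) :
  germ_src g = germ_rng (germ h) -> exists t (k : val (bd_act h) (Jdom t)),
  g = germ k.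
Proof.
elim/germ_ind: g => t psi k; rewrite germ_srcE germ_rngE => E.
by subst psi; exists t, k.
Qed.

Lemma germ_mulP s t chi (k : val chi (Jdom t)) (h : val (bd_act k) (Jdom s)) :
  exists st : val chi (Jdom (Il_mul s t)),
    germ_mul (germ h) (germ k) = germ st.
Proof.
by exists (germ_mul_subproof h erefl); exact: germ_mulE.
Qed.

Lemma germ_src_mul g h : germ_src g = germ_rng h ->
  germ_src (germ_mul g h) = germ_src h.
Proof.
elim/germ_ind: h => t chi k /composableP[s [h ->]].
by have [st ->] := germ_mulP h; rewrite !germ_srcE.
Qed.

Lemma germ_rng_mul g h : germ_src g = germ_rng h ->
  germ_rng (germ_mul g h) = germ_rng g.
Proof.
elim/germ_ind: h => t chi k /composableP[s [h ->]].
have [st ->] := germ_mulP h; rewrite !germ_rngE.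
by apply: val_inj; exact: act_mul.
Qed.

Lemma germ_mulA g h k : germ_src g = germ_rng h -> germ_src h = germ_rng k ->
  germ_mul g (germ_mul h k) = germ_mul (germ_mul g h) k.
Proof.
elim/germ_ind: k => u chi hu gh /composableP[t [ht hE]].
move: gh; rewrite hE => /composableP[s [hs ->]].
have [tu tuE] := germ_mulP ht; have [st stE] := germ_mulP hs.
have [stu stuE] := germ_mulP st; rewrite tuE stE stuE.
have E : bd_act ht = bd_act tu by apply: val_inj; rewrite /= act_mul.
have hs' : val (bd_act tu) (Jdom s) by rewrite -E.
have [stu'] := germ_mulP hs'; rewrite -(germ_irr hs hs' E) => ->.
apply/germP; split=> //; exists (val (Jdom (Il_mul (Il_mul s t) u))).
  exact: gf_J.
apply: pbij_ext => x y; rewrite !pb_restrictE.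
split=> -[dx b]; split=> //.
  by move: b => [z [w xw wz] zy]; exists w => //; exists z.
by move: b => [w xw [z wz zy]]; exists z => //; exists w.
Qed.

Lemma germ_mul1g g : germ_mul (germ_one (germ_rng g)) g = g.
Proof.
elim/germ_ind: g => s chi h; rewrite germ_rngE.
have k : val (bd_act h) (Jdom (Il_id (Jdom (Il_inv s)))).
  by rewrite Jdom_id; exact: germ_inv_subproof.
rewrite (germ_oneE k); have [st ->] := germ_mulP k.
apply/germP; split=> //; exists (val (Jdom s)); first exact: gf_J.
apply: pbij_ext => x y; rewrite !pb_restrictE; split=> -[dx b]; split=> //.
  by move: b => [z xz [_ E]]; subst z.
by exists y => //; split=> //; exists x.
Qed.

Lemma germ_mulg1 g : germ_mul g (germ_one (germ_src g)) = g.
Proof.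
elim/germ_ind: g => s chi h; rewrite germ_srcE.
have k : val chi (Jdom (Il_id (Jdom s))) by rewrite Jdom_id.
rewrite (germ_oneE k).
have h' : val (bd_act k) (Jdom s) by rewrite bd_act_id.
have [st] := germ_mulP h'.
rewrite -(germ_irr h h' (esym (bd_act_id k))) => ->.
apply/germP; split=> //; exists (val (Jdom s)); first exact: gf_J.
apply: pbij_ext => x y; rewrite !pb_restrictE; split=> -[dx b]; split=> //.
by case: b.
Qed.

Lemma germ_mulVg g : germ_mul (germ_inv g) g = germ_one (germ_src g).
Proof.
elim/germ_ind: g => s chi h; rewrite germ_srcE germ_invE.
have k : val chi (Jdom (Il_id (Jdom s))) by rewrite Jdom_id.
rewrite (germ_oneE k); have [st ->] := germ_mulP (germ_inv_subproof h).
apply/germP; split=> //; exists (val (Jdom s)); first exact: gf_J.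
apply: pbij_ext => x y; rewrite !pb_restrictE; split=> -[dx b]; split=> //.
  by move: b => [z xz yz]; split=> //; exact: graph_inj xz yz.
by move: dx b => [z xz] [_ E]; subst y; exists z.
Qed.

Lemma germ_mulgV g : germ_mul g (germ_inv g) = germ_one (germ_rng g).
Proof.
have invK : germ_inv (germ_inv g) = g.
  elim/germ_ind: g => s chi h; rewrite !germ_invE.
  have E : bd_act (germ_inv_subproof h) = chi.
    by apply: val_inj; rewrite /= act_invK //; exact: bdO_Jhat.
  apply/germP; split=> //; exists (val (Jdom s)); last exact: pbij_ext.
  by rewrite E; exact: gf_J.
by rewrite -{1}invK germ_mulVg germ_src_inv.
Qed.

Lemma germ_pairs_openP (W : set germ_pairs) :
  open W <-> forall s chi (h : val chi (Jdom s)), W (mkpair h) ->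
    nbhs chi [set psi : bdO | forall k : val psi (Jdom s), W (mkpair k)].
Proof.
split=> [[O oO <-] s chi h /= Oh|H].
  have [[A B] /= [nA nB] AB] := open_nbhs_nbhs (conj oO Oh).
  apply: filterS nB => psi Bpsi k; apply: AB; split=> //=.
  exact: nbhs_singleton nA.
rewrite openE => -[[s chi] hm] Wp.
have h : val chi (Jdom (s : Il C)) by exact: (set_mem hm).
have E : exist _ (s, chi) hm = mkpair h by exact: val_inj.
rewrite E in Wp; have := H _ _ _ Wp; rewrite nbhsE => -[B [oB Bchi] BW].
rewrite /interior; rewrite nbhsE.
exists (val @^-1` ([set s : discrete_topology (Il C)] `*` B)); last first.
  move=> [[t psi] km] /= [ts Bpsi]; subst t.
  have k : val psi (Jdom (s : Il C)) by exact: (set_mem km).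
  have -> : exist _ (s : discrete_topology (Il C), psi) km = mkpair k.
    exact: val_inj.
  exact: BW Bpsi k.
split; last by split.
exists ([set s : discrete_topology (Il C)] `*` B) => //.
rewrite openE => -[a b] [/= -> Bb].
exists ([set s : discrete_topology (Il C)], B) => //; split=> /=.
  by apply: open_nbhs_nbhs; split=> //; exact: discrete_open.
exact: open_nbhs_nbhs.
Qed.

Lemma germ_openP (W : set germs) :
  open W <-> forall s chi (h : val chi (Jdom s)), W (germ h) ->
    nbhs chi [set psi : bdO | forall k : val psi (Jdom s), W (germ k)].
Proof. exact: germ_pairs_openP. Qed.

Lemma dom_nbhs s chi : val chi (Jdom s) ->
  nbhs chi [set psi : bdO | val psi (Jdom s)].
Proof.
move=> h; apply: open_nbhs_nbhs; split=> //.
by exists [set psi : {ptws J C -> bool} | psi (Jdom s)] => //; exact: eval_open.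
Qed.

Lemma bd_act_continuous s chi (h : val chi (Jdom s)) (B : set bdO) :
  nbhs (bd_act h) B -> nbhs chi [set psi : bdO | forall k, B (@bd_act s psi k)].
Proof.
move=> [_ [[O oO <-] /= Oh OB]].
have nO : nbhs (val chi : {ptws J C -> bool}) (act s @^-1` O).
  exact: act_continuous (open_nbhs_nbhs (conj oO Oh)).
have : nbhs chi (val @^-1` (act s @^-1` O)) by exact: initial_continuous nO.
by apply: filterS => psi Opsi k; exact: OB.
Qed.

Definition bisection s (U : set bdO) : set germs :=
  [set g | exists chi (h : val chi (Jdom s)), U chi /\ g = germ h].

Lemma bisection_open s U : open U -> open (bisection s U).
Proof.
move=> oU; apply/germ_openP => t chi h [psi [k [Upsi /germP[E [a Ea ts]]]]].
subst psi; have [O [oO Ochi OE]] := gf_open Ea.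
have nO : nbhs chi (val @^-1` O).
  by apply: open_nbhs_nbhs; split=> //; exists O.
have nU : nbhs chi U by apply: open_nbhs_nbhs.
have nS := dom_nbhs k.
apply: filterS (filterI nO (filterI nU nS)) => psi [/= Opsi [Upsi' spsi]] h'.
exists psi, spsi; split=> //; apply/germP; split=> //; exists a => //.
exact: OE.
Qed.

Lemma germ_src_continuous : continuous germ_src.
Proof.
apply/continuousP => A oA; apply/germ_openP => s chi h; rewrite /= germ_srcE.
move=> Achi; apply: filterS (open_nbhs_nbhs (conj oA Achi)) => psi Apsi k.
by rewrite germ_srcE.
Qed.

Lemma germ_one_continuous : continuous germ_one.
Proof.
move=> chi W; rewrite nbhsE => -[V [oV Vchi] VW].
set e := sval (germ_one_subproof chi).
have /germ_openP/(_ _ _ (germ_one_subproof2 chi) Vchi) nV := oV.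
have nS := dom_nbhs (germ_one_subproof2 chi).
rewrite nbhs_simpl /=.
apply: filterS (filterI nV nS) => psi [/= Vpsi spsi].
by apply: VW; rewrite (germ_oneE spsi); exact: Vpsi.
Qed.

Lemma germ_inv_continuous : continuous germ_inv.
Proof.
apply/continuousP => A /germ_openP oA; apply/germ_openP => s chi h.
rewrite /= germ_invE => /oA/bd_act_continuous; apply: filterS => psi H k.
by rewrite germ_invE; exact: H.
Qed.

Lemma germ_mul_continuous :
  {within [set gh : germs * germs | germ_src gh.1 = germ_rng gh.2],
    continuous (fun gh => germ_mul gh.1 gh.2)}.
Proof.
apply/subspace_continuousP => -[g h] /=.
elim/germ_ind: h => t chi k /composableP[s [h ->]] W.
have [st stE] := germ_mulP h; rewrite /from_subspace /= stE nbhsE => -[V [oV Vst] VW].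
have nV : nbhs chi [set psi : bdO | forall l : val psi (Jdom (Il_mul s t)), V (germ l)].
  by move/germ_openP: oV; apply.
move: nV; rewrite nbhsE => -[B [oB Bchi] BV].
rewrite nbhs_simpl /= /within /=.
have nG : nbhs (germ h) (bisection s setT).
  apply: open_nbhs_nbhs; split; first by apply: bisection_open; exact: openT.
  by exists (bd_act k), h.
have nH : nbhs (germ k) (bisection t B).
  by apply: open_nbhs_nbhs; split; [exact: bisection_open|exists chi, k].
exists (bisection s setT, bisection t B) => //.
move=> [_ _] /= [[psi' [h' [_ ->]]] [psi [k' [Bpsi ->]]]].
rewrite germ_srcE germ_rngE => E; subst psi'.
by have [st' ->] := germ_mulP h'; apply/VW/BV.
Qed.

Lemma germ_src_local_homeo g : exists U : set germs,
  [/\ open U, U g, {in U &, injective germ_src} &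
      forall V, open V -> V `<=` U -> open (germ_src @` V)].
Proof.
elim/germ_ind: g => s chi h; exists (bisection s setT); split.
- by apply: bisection_open; exact: openT.
- by exists chi, h.
- move=> _ _ /set_mem[psi [k [_ ->]]] /set_mem[psi' [k' [_ ->]]].
  by rewrite !germ_srcE; exact: germ_irr.
- move=> V /germ_openP oV VU.
  rewrite openE => _ [g Vg <-]; have [psi [k [_ gE]]] := VU _ Vg.
  subst g; rewrite germ_srcE /interior.
  have nS := dom_nbhs k.
  apply: filterS (filterI (oV _ _ _ Vg) nS) => psi' [/= H k'].
  by exists (germ k'); [exact: H|exact: germ_srcE].
Qed.

Definition germ_groupoid : etale_groupoid :=
  EtaleGroupoid germ_src_one germ_rng_one germ_src_inv germ_rng_inv
    germ_src_mul germ_rng_mul germ_mulA germ_mul1g germ_mulg1 germ_mulVg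
    germ_mulgV germ_src_continuous germ_one_continuous germ_inv_continuous
    germ_mul_continuous germ_src_local_homeo.

End germ_groupoid.

(* The groupoids I_l \ltimes \partial\Omega and
   I_l \bar\ltimes \partial\Omega. *)
Definition transformation_groupoid (C : lcCategory) : etale_groupoid :=
  germ_groupoid (germJ C).

Definition transformation_groupoid_bar (C : lcCategory) : etale_groupoid :=
  germ_groupoid (germJbar C).

(* Main.v *)
Require Import Defs.
From HB Require Import structures.
From mathcomp Require Import all_boot.
From mathcomp Require Import all_classical topology.

Local Open Scope classical_set_scope.

(** Both groupoids have the same orbits on the boundary, those of the action of
    I_l, so they are minimal simultaneously.  Maximality of chi means that
    chi(f) = 0 forces chi(g) = 1 for some g disjoint from f; hence the sets
    U(f) = {chi | chi(f) = 1}, f non-empty, form a pi-base of the boundary, and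
    minimality says that every orbit meets every U(f).  If this holds, the open
    sets {chi | (s.chi)(f) = 1} cover the compact set U(e), and a finite
    subcover gives (iii).  Conversely, given (iii) and chi(e) = 1, some s_i has
    chi(s_i f s_i^-1) = 1: otherwise a maximal character close to chi would take
    the value 1 on some e' <= e disjoint from all s_i f s_i^-1. *)

Section characters.
Context {C : lcCategory}.
Local Notation fspace := {ptws J C -> bool}.
Implicit Types (chi psi : fspace) (s : Il C) (e f g : J C).

(** * Maximal characters *)

Lemma Jhat_nonempty chi e : Jhat C chi -> chi e -> val e !=set0.
Proof. by move=> [_ _ chi0] ce; apply/set0P/eqP => /chi0; rewrite ce. Qed.

(** If [f] met every member of the filter [chi], the filter generated by both would be proper, hence
    equal to [chi] by maximality, and would contain [f]. *)
Lemma max_character_disjoint chi f : max_character C chi -> ~~ chi f ->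
  exists2 g, chi g & val g `&` val f = set0.
Proof.
move=> [chiJ chiM] /negP nf; apply: contrapT => H.
have meets g : chi g -> val g `&` val f !=set0.
  by move=> cg; apply/set0P/eqP => gf0; apply: H; exists g.
(* the character of the filter generated by [chi] and [f] *)
pose psi : fspace := fun h => `[< exists2 g, chi g & val g `&` val f `<=` val h >].
have psiJ : Jhat C psi.
  split.
  - case: chiJ => -[g cg] _ _.
    by exists g; apply/asboolP; exists g => //; exact: subIsetl.
  - move=> a b; apply/asboolP/andP.
      by move=> [g cg gab]; split; apply/asboolP; exists g => // x /gab[].
    move=> [/asboolP[g cg ga] /asboolP[h ch hb]].
    exists (Jmeet g h); first exact: Jhat_meet.
    by move=> x [[gx hx] fx]; split; [exact: ga|exact: hb].
  - move=> a a0; apply/negbTE/asboolP => -[g cg].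
    by rewrite a0; have [x gfx] := meets _ cg => /(_ _ gfx).
apply: nf; have [g0 cg0] : exists g, chi g by case: chiJ.
have /(congr1 (@^~ f)) /= <- : [set e | psi e] = [set e | chi e].
  apply: chiM => // a ca; apply/asboolP; exists a => //; exact: subIsetl.
by apply/asboolP; exists g0 => //; exact: subIsetr.
Qed.

Lemma max_character_disjoint_seq chi e (fs : seq (J C)) :
  max_character C chi -> chi e -> (forall f, f \in fs -> ~~ chi f) ->
  exists g, [/\ chi g, val g `<=` val e &
    forall f, f \in fs -> val g `&` val f = set0].
Proof.
move=> chiM ce; elim: fs => [|f fs IH] H; first by exists e; split.
have [|g [cg ge gfs]] := IH; first by move=> f' ff; apply: H; rewrite inE ff orbT.
have [|h ch hf] := max_character_disjoint _ f chiM.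
  by apply: H; rewrite inE eqxx.
exists (Jmeet g h); split.
- by apply: Jhat_meet => //; case: chiM.
- by move=> x [/ge].
- move=> f'; rewrite inE => /predU1P[->|/gfs gf'].
    by apply/seteqP; split=> // x [[_ hx] fx]; rewrite -hf.
  by apply/seteqP; split=> // x [[gx _] fx]; rewrite -gf'.
Qed.

(** If [chi] vanished on all of [fs], a non-empty [g] below [e] would be disjoint from their union,
    which is [e]. *)
Lemma max_character_Omega chi : max_character C chi -> Omega C chi.
Proof.
move=> chiM; have [chiJ _] := chiM; split=> // e fs eE ce.
apply: contrapT => H.
have [f ff|g [cg ge gfs]] := max_character_disjoint_seq _ _ fs chiM ce.
  by apply/negP => cf; apply: H; exists f.
have [x gx] := Jhat_nonempty _ _ chiJ cg.
have := ge _ gx; rewrite eE => -[f ff fx].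
suff : set0 x by []; rewrite -(gfs f ff); split=> //.
Qed.

Lemma max_character_exists e : val e !=set0 ->
  exists2 chi, max_character C chi & chi e.
Proof.
move=> e0.
(* [A e] cannot be part of [P], which must hold for the union of the empty chain; maximality
   supplies it, along with upward closure, through [upE]. *)
pose P (A : set (J C)) := (forall a b, A a -> A b -> A (Jmeet a b)) /\
  (forall a, A a -> val a `&` val e !=set0).
have [F FP totF|A [[AM A0] Amax]] := @Zorn_bigcup _ P.
  split=> [a b [X FX Xa] [Y FY Yb]|a [X FX Xa]]; last exact: (FP _ FX).2.
  have [XY|YX] := totF _ _ FX FY.
    by exists Y => //; apply: (FP _ FY).1 => //; exact: XY.
  by exists X => //; apply: (FP _ FX).1 => //; exact: YX.
have AmaxE B : P B -> A `<=` B -> B = A.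
  by move=> PB AB; apply: contrapT => nBA; apply: (Amax B) => //; split=> // BA;
    apply: nBA; apply/seteqP.
have upE : [set h | val e `<=` val h \/
    exists2 a, A a & val a `&` val e `<=` val h] = A.
  apply: AmaxE; last by move=> a Aa; right; exists a => //; exact: subIsetl.
  split.
    move=> a b [ea|[c Ac ca]] [eb|[d Ad db]].
    - by left=> x ex; split; [exact: ea|exact: eb].
    - by right; exists d => // x dx; split; [apply: ea; case: dx|exact: db].
    - by right; exists c => // x cx; split; [exact: ca|apply: eb; case: cx].
    - right; exists (Jmeet c d); first exact: AM.
      by move=> x [[cx dx] ex]; split; [exact: ca|exact: db].
  move=> a [ea|[c Ac ca]].
    by case: e0 => x ex; exists x; split=> //; exact: ea.
  by have [x cx] := A0 _ Ac; exists x; split; [exact: ca|case: cx].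
have Ae : A e by rewrite -upE; left.
have Aup a b : val a `<=` val b -> A a -> A b.
  by move=> ab Aa; rewrite -upE; right; exists a => // x [/ab].
exists (fun a => `[< A a >]); last exact/asboolP.
split.
  split; first by exists e; exact/asboolP.
  - move=> a b; apply/asboolP/andP.
      by move=> Aab; split; apply/asboolP; apply: Aup Aab => x [].
    by move=> [/asboolP Aa /asboolP Ab]; exact: AM.
  - move=> a a0; apply/negbTE/asboolP => /A0[x].
    by rewrite a0 => -[].
move=> psi psiJ sub.
have -> : [set a | `[< A a >]] = A by apply/seteqP; split=> x /asboolP.
apply: AmaxE => [|a Aa]; last exact/sub/asboolP.
have pe : psi e by exact/sub/asboolP.
split=> [a b /= pa pb|a /= pa]; first exact: Jhat_meet.
by apply: (Jhat_nonempty _ (Jmeet a e) psiJ); exact: Jhat_meet.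
Qed.

(** * Pointwise topology and closure of the maximal characters *)

Definition agree_on (L : seq (J C)) chi : set fspace :=
  [set psi | forall e, e \in L -> psi e = chi e].

Lemma nbhs_agree_on L chi : nbhs chi (agree_on L chi).
Proof.
elim: L => [|e L IH]; first by apply: filterS filterT => psi _ e.
have nE : nbhs chi [set psi : fspace | psi e = chi e].
  case ce: (chi e).
    exact: open_nbhs_nbhs (conj (eval_open e) ce).
  have : nbhs chi [set psi : fspace | ~~ psi e].
    by apply: open_nbhs_nbhs; split; [exact: eval_openN|rewrite /= ce].
  by apply: filterS => psi /negbTE.
apply: filterS (filterI nE IH) => psi [pe pL] f.
by rewrite inE => /predU1P[->|/pL].
Qed.

(** Convergence of the filter based on the sets [agree_on L chi] is tested one coordinate at a time,
    where [[:: e]] suffices. *)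
Lemma nbhs_agreeP chi (B : set fspace) :
  nbhs chi B -> exists L, agree_on L chi `<=` B.
Proof.
pose F := filter_from [set: seq (J C)] (fun L => agree_on L chi).
have FF : Filter F.
  apply: filter_fromT_filter; first by exists [::].
  move=> L M; exists (L ++ M) => psi H.
  by split=> e eL; apply: H; rewrite mem_cat eL ?orbT.
suff : F --> chi by move=> cvF /cvF[L _ LB]; exists L.
apply/cvg_sup => e A [_ [[V oV <-] Vchi VA]].
exists [:: e] => // psi H; apply: VA.
by rewrite /= H ?inE.
Qed.

Lemma closure_max_character_agree chi L : closure (max_character C) chi ->
  exists2 psi, max_character C psi & agree_on L chi psi.
Proof. by move=> /(_ _ (nbhs_agree_on L chi))[psi []]; exists psi. Qed.

(** Each axiom except non-vanishing involves finitely many values, so it is inherited from a maximal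
    character agreeing with [chi] there; [chi e] gives non-vanishing. *)
Lemma closure_max_character_bdOmega chi e :
  closure (max_character C) chi -> chi e -> bdOmega C chi.
Proof.
move=> clchi ce; split=> //.
have agree L := closure_max_character_agree _ L clchi.
split; first split.
- by exists e.
- move=> a b; have [psi [[_ psiM _] _] E] := agree [:: Jmeet a b; a; b].
  by rewrite -!E ?psiM ?inE ?eqxx ?orbT.
- move=> a a0; have [psi [[_ _ psi0] _] E] := agree [:: a].
  by rewrite -E ?psi0 ?inE.
- move=> a fs aE ca; have [psi /max_character_Omega[_ psiU] E] := agree (a :: fs).
  have [|f ff pf] := psiU a fs aE; first by rewrite E ?inE ?eqxx.
  by exists f => //; rewrite -E ?inE ?ff ?orbT.
Qed.

(** This set is U(e), presented as a closed subset of the product of copies of [bool]. *)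
Lemma compact_closure_max_character e :
  compact (closure (max_character C) `&` [set chi | chi e]).
Proof.
have cT : compact [set: fspace].
  have := @tychonoff _ (fun _ : J C => _) _ (fun=> bool_compact).
  by congr (compact _); rewrite eqEsubset.
have ce : closed [set chi : fspace | chi e].
  have -> : [set chi : fspace | chi e] = ~` [set chi | ~~ chi e].
    by apply/seteqP; split=> chi /=; [move=> ->|move/negP; rewrite negbK].
  by apply: open_closedC; exact: eval_openN.
apply: (subclosed_compact _ cT) => //; apply: closedI => //.
exact: closed_closure.
Qed.

(** * Reduction from germs to the action of I_l *)

Lemma act_true_dom s chi f : Jhat C chi -> act s chi f -> chi (Jdom s).
Proof. by move=> chiJ; apply: (Jhat_mono chiJ) => x [y _ xy]; exists y. Qed.

Definition bd_of chi (h : bdOmega C chi) : bdOmega C := exist _ chi (mem_set h).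

Definition act_minimal := forall A : set (bdOmega C), closed A ->
  (forall s (chi : bdOmega C) (h : val chi (Jdom s)),
     A chi -> A (bd_act h)) -> A = set0 \/ A = setT.

(** Every germ goes from some [chi] to [bd_act h], whatever [F] is, so the invariant sets are those
    of the action. *)
Lemma minimal_germ_groupoidP (F : germ_family C) :
  minimal_groupoid (germ_groupoid F) <-> act_minimal.
Proof.
have invP (A : set (bdOmega C)) :
    (@invariant_set (germ_groupoid F) A) <->
    (forall s (chi : bdOmega C) (h : val chi (Jdom s)), A chi -> A (bd_act h)).
  split=> [inv s chi h Achi|inv g]; last exact: inv (germ_repP g).
  by have := inv (germ F h); rewrite /= germ_srcE germ_rngE; exact.
by split=> H A cA /invP; exact: H.
Qed.

Definition finitely_covering := forall e f : J C, val e !=set0 -> val f !=set0 ->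
  exists (n : nat) (s : 'I_n -> Il C),
    forall e' : J C, val e' !=set0 -> val e' `<=` val e ->
      exists i : 'I_n, val (Jmeet e' (Jconj (s i) f)) !=set0.

(** * From minimality to the covering condition *)

Lemma act_minimal_orbit f (chi : bdOmega C) : act_minimal -> val f !=set0 ->
  exists s, act s (val chi) f.
Proof.
move=> minC f0.
(* The points whose orbit misses U(f). Here [s] may range over all of I_l: by [act_true_dom],
   [act s] never gives [f] the value 1 off the domain of [s]. *)
pose A : set (bdOmega C) := [set psi | forall s, ~~ act s (val psi) f].
have cA : closed A.
  rewrite (_ : A = \bigcap_(s in [set: Il C])
      (val @^-1` (act s @^-1` [set psi : fspace | ~~ psi f]))); last first.
    by apply/seteqP; split=> psi H s; [move=> _|]; exact: H.
  apply: closed_bigI => s _.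
  have -> : val @^-1` (act s @^-1` [set psi : fspace | ~~ psi f]) =
      ~` (val @^-1` (act s @^-1` [set psi : fspace | psi f])) :> set (bdOmega C).
    by apply/seteqP; split=> psi /negP.
  apply: open_closedC; exists (act s @^-1` [set psi : fspace | psi f]) => //.
  by apply: open_comp => [psi _|]; [exact: act_continuous|exact: eval_open].
have [t psi h Apsi s||AT] := minC A cA.
- by rewrite /= -act_mul.
- move=> A0; apply: contrapT => H; suff : A chi by rewrite A0.
  by move=> s; apply/negP => sf; apply: H; exists s.
- have [psi psiM pf] := max_character_exists _ f0.
  have psibd : bdOmega C psi.
    by split; [exact: max_character_Omega|exact: subset_closure].
  have : A (bd_of _ psibd) by rewrite AT.
  move=> /(_ (Il_id f)); rewrite act_id //; last by case: psiM.
  by rewrite /= pf.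
Qed.

Lemma act_minimal_covering : act_minimal -> finitely_covering.
Proof.
move=> minC e f e0 f0.
have /compact_near_coveringP := compact_closure_max_character e.
(* Near-covering along the filter of ever larger finite lists yields one list [L]: the finite
   subcover. *)
pose F := filter_from [set: seq (Il C)] (fun L => [set M : seq (Il C) | {subset L <= M}]).
have FF : Filter F.
  apply: filter_fromT_filter => [|L M]; first by exists [::].
  exists (L ++ M) => N H; split=> s sL; apply: H; rewrite mem_cat sL ?orbT //.
move=> /(_ _ F (fun L chi => exists2 s, s \in L & act s chi f) FF)
  [chi [clchi ce]|L _ /(_ L) Lcov].
  have bdchi := closure_max_character_bdOmega _ _ clchi ce.
  have [s sf] := act_minimal_orbit _ (bd_of _ bdchi) minC f0.
  exists ([set psi | act s psi f], [set M : seq (Il C) | s \in M]).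
    split; last by exists [:: s] => // M; apply; rewrite inE.
    have oU : open [set psi : fspace | act s psi f].
      exact: (eval_open (Jconj (Il_inv s) f)).
    exact: open_nbhs_nbhs (conj oU sf).
  by move=> [psi M] [/= psif sM]; exists s.
(* Inverses appear because (s.chi)(f) = chi(s^-1 f s). *)
exists (size L), (fun i => Il_inv (tnth (in_tuple L) i)) => e' e'0 e'e.
have [psi psiM pe'] := max_character_exists _ e'0.
have psiJ : Jhat C psi by case: psiM.
have [//||s /seq_tnthP[i sE] sf] := Lcov _ psi.
  by split; [exact: subset_closure|exact: Jhat_mono pe'].
exists i; apply: (Jhat_nonempty psi) => //.
by apply: Jhat_meet => //; rewrite -sE.
Qed.

(** * From the covering condition to minimality *)

Lemma covering_orbit e f chi : finitely_covering ->
  closure (max_character C) chi -> chi e -> val f !=set0 ->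
  exists s, chi (Jconj s f).
Proof.
move=> cov clchi ce f0.
have [psi psiM E] := closure_max_character_agree _ [:: e] clchi.
have e0 : val e !=set0.
  by apply: (Jhat_nonempty psi); [case: psiM|rewrite E ?inE].
have [n [s sP]] := cov e f e0 f0.
pose L := [seq Jconj (s i) f | i <- enum 'I_n].
apply: contrapT => H.
(* The first approximant only showed [e] non-empty, which produced [s]; the new one also agrees with
   [chi] on [L], hence vanishes there. *)
have {psi psiM E} [psi psiM E] := closure_max_character_agree _ (e :: L) clchi.
have [||g [pg ge gL]] := max_character_disjoint_seq psi e L psiM.
- by rewrite E ?inE ?eqxx.
- move=> h hL; rewrite E ?inE ?hL ?orbT //; apply/negP => ch.
  by move/mapP: hL => [i _ hE]; apply: H; exists (s i); rewrite -hE.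
have [|i [x gx]] := sP g _ ge; first by apply: (Jhat_nonempty psi) => //; case: psiM.
suff : set0 x by []; rewrite -(gL (Jconj (s i) f)) //.
by apply: map_f; rewrite mem_enum.
Qed.

(* The sets {psi | psi f} form a pi-base of the boundary. *)
Lemma max_character_agree_sub chi L : max_character C chi ->
  exists2 f, chi f & forall psi, Jhat C psi -> psi f -> agree_on L chi psi.
Proof.
move=> chiM; have [chiJ _] := chiM.
elim: L => [|e L [f cf fL]].
  by have [[f cf] _ _] := chiJ; exists f.
suff [g cg gE] : exists2 g, chi g & forall psi, Jhat C psi -> psi g -> psi e = chi e.
  exists (Jmeet f g); first exact: Jhat_meet.
  move=> psi psiJ; have [_ -> _] := psiJ => /andP[pf pg] h.
  by rewrite inE => /predU1P[->|]; [exact: gE|exact: fL].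
(* If [chi e] fails, a [g] disjoint from [e] forces [psi e] to fail too. *)
case ce : (chi e); first by exists e.
have [|g cg ge] := max_character_disjoint _ e chiM; first by rewrite ce.
exists g => // psi psiJ pg; apply/negbTE/negP => pe.
have [x gex] := Jhat_nonempty _ _ psiJ (Jhat_meet psiJ pg pe).
by suff : set0 x by []; rewrite -ge.
Qed.

(** The orbit of any [chi] in [A] stays in [A] and meets every U(f), so it is dense, and [A] is
    closed. *)
Lemma covering_act_minimal : finitely_covering -> act_minimal.
Proof.
move=> cov A cA invA; have [|/set0P[chi Achi]] := eqVneq A set0; first by left.
right; apply/seteqP; split=> // psi _; apply: cA => B.
rewrite /= => -[_ [[O oO <-] /= Opsi OB]].
have [psi' [psiM Opsi']] :=
  (bdOP psi).2 O (open_nbhs_nbhs (conj oO Opsi)).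
have [L LO] := nbhs_agreeP _ _ (open_nbhs_nbhs (conj oO Opsi')).
have [f pf fL] := max_character_agree_sub _ L psiM.
have f0 : val f !=set0 by apply: (Jhat_nonempty psi') => //; case: psiM.
have chiJ := bdO_Jhat chi.
have [[e ce] _ _] := chiJ.
have [s sf] := covering_orbit _ _ _ cov (bdOP chi).2 ce f0.
have sfE : act (Il_inv s) (val chi) f.
  by apply: (Jhat_mono chiJ) sf => x [y fy yx]; exists y.
have h := act_true_dom _ _ _ chiJ sfE.
exists (bd_act h); split; first exact: invA.
by apply: OB; apply/LO/fL => //; exact: bdO_Jhat (bd_act h).
Qed.

End characters.

Theorem lemma5p4 (C : lcCategory) :
  (minimal_groupoid (transformation_groupoid C) <->
   minimal_groupoid (transformation_groupoid_bar C)) /\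
  (minimal_groupoid (transformation_groupoid_bar C) <->
   (forall e f : J C, val e !=set0 -> val f !=set0 ->
    exists (n : nat) (s : 'I_n -> Il C),
      forall e' : J C, val e' !=set0 -> val e' `<=` val e ->
        exists i : 'I_n, val (Jmeet e' (Jconj (s i) f)) !=set0)).
Proof.
split; first by rewrite !minimal_germ_groupoidP.
rewrite minimal_germ_groupoidP; split; first exact: act_minimal_covering.
exact: covering_act_minimal.
Qed.
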